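(* Let $F_2$ be the free group of rank 2 and let $R$ be a normal subgroup of $F_2$ with $R\subseteq [F_2,F_2]$. Let $\rho: Stab(R)\to Aut(F_2/R)$ be the natural homomorphism. If $\varphi\in Ker(\rho)$, then $\varphi$ is an inner automorphism of $F_2$ induced by an element $s\in F_2$ such that $sR$ is central in $F_2/R$.
   Context: For a normal subgroup $R$ of a free group $F$, $Stab(R)=\{\varphi\in Aut(F): \varphi(R)=R\}$. The natural homomorphism $\rho: Stab(R)\to Aut(F/R)$ sends $\varphi$ to the automorphism $sR\mapsto \varphi(s)R$ of $F/R$. $[F_2,F_2]$ is the commutator subgroup of $F_2$. The inner automorphism induced by $s$ is conjugation by $s$. *)

(* Defs.v *)
From HB Require Import structures.
From mathcomp Require Import all_boot.
From mathcomp Require Import boolp classical_sets.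

Set Implicit Arguments.
Unset Strict Implicit.
Unset Printing Implicit Defensive.

Local Open Scope classical_set_scope.
Local Open Scope group_scope.
Local Open Scope quotient_scope.

Notation hom := UMagmaMorphism.type.

(* e : I -> F is a free basis of F: every map from I to a group G extends
   uniquely along e to a homomorphism F -> G. *)
Definition free_basis (F : groupType) (I : Type) (e : I -> F) : Prop :=
  forall (G : groupType) (f : I -> G),
    exists h : hom F G,
      h \o e =1 f /\
      forall h' : hom F G, h' \o e =1 f -> h' =1 h.

Definition free_of_rank (n : nat) (F : groupType) : Prop :=
  exists e : 'I_n -> F, free_basis e.

Definition subgroup (G : groupType) (H : set G) : Prop :=
  [/\ H 1, forall x y, H x -> H y -> H (x * y) & forall x, H x -> H x^-1].

Definition commutator_subgroup (G : groupType) : set G :=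
  smallest (@subgroup G) [set z | exists x y, z = [~ x, y]].

Definition center (G : groupType) : set G := [set z | forall x, commute z x].

Arguments commutator_subgroup : clear implicits.
Arguments center : clear implicits.

Record normal_subgroup (G : groupType) := NormalSubgroup {
  nset :> set G;
  nset_subgroup : subgroup nset;
  nset_conj : forall x y, nset x -> nset (x ^ y) }.

Record aut (G : groupType) := Aut {
  aut_fun :> hom G G;
  aut_bij : bijective aut_fun }.

Section Inner.
Variables (G : groupType) (s : G).

(* MathComp's convention: x ^ s = s^-1 * x * s. *)
Definition inner_fun (x : G) : G := x ^ s.

Lemma inner_fun_hom : monoid_morphism inner_fun.
Proof. by split=> [|x y]; rewrite /inner_fun ?conj1g ?conjMg. Qed.

HB.instance Definition _ := isUMagmaMorphism.Build G G inner_fun inner_fun_hom.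

Lemma inner_fun_bij : bijective inner_fun.
Proof. by exists (conjg^~ s^-1) => x; rewrite /inner_fun ?conjgK ?conjgKV. Qed.

Definition inner : aut G := Aut inner_fun_bij.
End Inner.

Section Quotient.
Variables (G : groupType) (R : normal_subgroup G).

(* x R = y R *)
Definition coset_rel : rel G := fun x y => `[< nset R (x^-1 * y) >].

Lemma nset1 : nset R 1. Proof. by case: (nset_subgroup R). Qed.
Lemma nsetM x y : nset R x -> nset R y -> nset R (x * y).
Proof. by case: (nset_subgroup R) => _ + _; apply. Qed.
Lemma nsetV x : nset R x -> nset R x^-1.
Proof. by case: (nset_subgroup R) => _ _; apply. Qed.

Lemma coset_rel_equiv : equiv_class_of coset_rel.
Proof.
split=> [x|x y|y x z]; rewrite /coset_rel.
- by apply/asboolP; rewrite mulVg; exact: nset1.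
- by apply/asboolP/asboolP => /nsetV; rewrite invgM invgK.
- move=> /asboolP xy /asboolP yz; apply/asboolP.
  by have := nsetM xy yz; rewrite mulgA mulgK.
Qed.

Canonical coset_equiv := EquivRelPack coset_rel_equiv.
Definition quot := {eq_quot coset_equiv}.
HB.instance Definition _ := Choice.on quot.
HB.instance Definition _ := EqQuotient.on quot.

Definition coset (x : G) : quot := \pi_quot x.

Lemma cosetP x y : (coset x = coset y) <-> nset R (x^-1 * y).
Proof.
split=> [/eqquotP/asboolP//|xy]; by apply/eqquotP/asboolP.
Qed.

Lemma repr_coset x : nset R (x^-1 * repr (coset x)).
Proof. by apply/cosetP; rewrite /coset reprK. Qed.

Definition quot_one : quot := coset 1.
Definition quot_mul (a b : quot) : quot := coset (repr a * repr b).
Definition quot_inv (a : quot) : quot := coset (repr a)^-1.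

Lemma quot_mulE x y : quot_mul (coset x) (coset y) = coset (x * y).
Proof.
symmetry; apply/cosetP.
have := nsetM (repr_coset y) (nset_conj (repr (coset y)) (repr_coset x)).
by rewrite /conjg invgM !mulgA mulgK.
Qed.

Lemma quot_invE x : quot_inv (coset x) = coset x^-1.
Proof.
symmetry; apply/cosetP; rewrite invgK.
have := nset_conj x^-1 (nsetV (repr_coset x)).
by rewrite invgM invgK /conjg invgK !mulgA mulgK.
Qed.

Lemma cosetK (a : quot) : coset (repr a) = a.
Proof. exact: reprK. Qed.

Lemma quot_mulA : associative quot_mul.
Proof.
by move=> a b c; rewrite -(cosetK a) -(cosetK b) -(cosetK c) !quot_mulE mulgA.
Qed.
Lemma quot_1mul : left_id quot_one quot_mul.
Proof. by move=> a; rewrite -(cosetK a) quot_mulE mul1g. Qed.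
Lemma quot_mul1 : right_id quot_one quot_mul.
Proof. by move=> a; rewrite -(cosetK a) quot_mulE mulg1. Qed.
Lemma quot_mulV : left_inverse quot_one quot_inv quot_mul.
Proof. by move=> a; rewrite -(cosetK a) quot_invE quot_mulE mulVg. Qed.
Lemma quot_Vmul : right_inverse quot_one quot_inv quot_mul.
Proof. by move=> a; rewrite -(cosetK a) quot_invE quot_mulE mulgV. Qed.

HB.instance Definition _ := isGroup.Build quot
  quot_mulA quot_1mul quot_mul1 quot_mulV quot_Vmul.

Lemma cosetM : {morph coset : x y / x * y}.
Proof. by move=> x y; rewrite -quot_mulE. Qed.
End Quotient.

Definition Stab (G : groupType) (R : normal_subgroup G) :=
  {phi : aut G | phi @` R = R}.

Arguments Stab [G] R.

Section Rho.
Variables (G : groupType) (R : normal_subgroup G) (phi : Stab R).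

Definition rho_fun (a : quot R) : quot R := coset R (sval phi (repr a)).

Lemma rho_funE s : rho_fun (coset R s) = coset R (sval phi s).
Proof.
symmetry; apply/cosetP; have : (sval phi @` R) (sval phi (s^-1 * repr (coset R s))).
  by exists (s^-1 * repr (coset R s)) => //; exact: repr_coset.
by rewrite (svalP phi) gmulfM gmulfV.
Qed.

Lemma rho_fun_hom : monoid_morphism rho_fun.
Proof.
split=> [|a b]; first by rewrite rho_funE gmulf1.
by rewrite -(cosetK a) -(cosetK b) -cosetM !rho_funE gmulfM cosetM.
Qed.

HB.instance Definition _ :=
  isUMagmaMorphism.Build (quot R) (quot R) rho_fun rho_fun_hom.

Lemma rho_fun_bij : bijective rho_fun.
Proof.
have [g gK Kg] := aut_bij (sval phi).
exists (fun a => coset R (g (repr a))) => a; last first.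
  by rewrite rho_funE Kg cosetK.
rewrite -[RHS]cosetK; symmetry; apply/cosetP.
have := repr_coset R (sval phi (repr a)); rewrite -/(rho_fun a).
rewrite -{1}(svalP phi) => -[r Rr].
move=> /(congr1 (mul (sval phi (repr a)))); rewrite mulgA mulgV mul1g -gmulfM.
by move=> <-; rewrite gK mulgA mulVg mul1g.
Qed.

Definition rho : aut (quot R) := Aut rho_fun_bij.
End Rho.

Definition ker_rho (G : groupType) (R : normal_subgroup G) : set (Stab R) :=
  [set phi | rho phi =1 idfun].

Arguments ker_rho [G] R.

(* Main.v *)
From HB Require Import structures.
From mathcomp Require Import all_boot ssralg ssrint zify.
Require Import Defs.
From mathcomp Require Import boolp classical_sets.

Set Implicit Arguments.
Unset Strict Implicit.
Unset Printing Implicit Defensive.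

(** An automorphism [phi] in the kernel of [rho] moves every [x] inside the
coset [x R], and [R] lies in the commutator subgroup, so [phi] acts trivially
on the abelianization of the free group on [a] and [b].  By a theorem of
Nielsen such an automorphism is inner; and if [phi] is conjugation by [s] and
trivial modulo [R], then [s R] is central.  The substance is Nielsen's theorem,
which is obtained here in two steps from the pair [(u, v) = (phi a, phi b)].

Reduction ([free2_generating_nielsen]).  Call two pairs Nielsen equivalent when
they are related by inversions, swaps, [(x, y) -> (x y, y)] and simultaneous
conjugations.  Any generating pair [(u, v)] of the free group of rank 2 is
equivalent to [(a, b)].  Indeed, take an equivalent pair of least total length.
Minimality bounds the cancellation between [u^±1] and [v^±1] by half of each
factor, and no factor is cancelled completely by its two neighbours: between
two equal letters this is excluded because a simultaneous conjugation would
shorten the pair ([nielsen_minimal_gap]), between two inverse letters because a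
word and its inverse cannot share half of their letters
([nielsen_minimal_gapV]).  Hence a reduced word with at least two
letters in [u], [v] has length at least two ([len_feval_gt1]), so that [a] and
[b] themselves must be among [u^±1], [v^±1].

Positivity ([nielsen_signed_positive]).  Consider the pairs obtained from some
[(a^±1, b^±1)] by swaps, multiplications [(x, y) -> (x y, y)] and simultaneous
conjugations, without inversions.  Up to inverting their entries these already
form a class closed under all Nielsen moves, because a division undoes the last
multiplication, or amounts to a multiplication in the other order, or, for an
initial pair [(x, y)], is a multiplication for the initial pair [(x, y^-1)]
([positive_div]).  Both entries of such a pair are, after one conjugation,
positive words in [x = a^±1] and [y = b^±1].  A positive word whose class in the
abelianization is that of [a^±1] can only be the letter [x].  So a pair
equivalent to [(a, b)] and equal to it in the abelianization is conjugate to
[(a, b)] ([nielsen_IA]).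

Lengths and cancellation are computed in a concrete model by reduced words,
where the overlap of [u] and [v] is the length of their longest common prefix
and [|u^-1 v| = |u| + |v| - 2 overlap u v]. *)

(** * Longest common prefixes *)

Section Lcp.
Variable T : eqType.
Implicit Types s t r : seq T.

Fixpoint lcp s t : nat :=
  match s, t with
  | x :: s', y :: t' => if x == y then (lcp s' t').+1 else 0
  | _, _ => 0
  end.

Lemma lcp_take k s t :
  (k <= lcp s t) = [&& k <= size s, k <= size t & take k s == take k t].
Proof.
elim: s t k => [|x s IHs] [|y t] [|k] //=.
  by rewrite andbF.
rewrite eqseq_cons; case: eqVneq => //= _; last by rewrite !andbF.
by rewrite !ltnS IHs.
Qed.

Lemma lcpC s t : lcp s t = lcp t s.
Proof. by elim: s t => [|x s IHs] [|y t] //=; rewrite IHs eq_sym. Qed.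

Lemma lcp_sizel s t : lcp s t <= size s.
Proof. by have := leqnn (lcp s t); rewrite lcp_take => /andP[]. Qed.

Lemma lcp_sizer s t : lcp s t <= size t.
Proof. by rewrite lcpC lcp_sizel. Qed.

Lemma lcp_trans k s t r : k <= lcp s t -> k <= lcp t r -> k <= lcp s r.
Proof.
rewrite !lcp_take => /and3P[-> _ /eqP->] /and3P[_ -> /eqP->].
by rewrite eqxx.
Qed.

(** Common prefixes are ultrametric: the two smallest of the three overlaps of
    three words agree. *)
Lemma lcp_isosceles s t r : lcp s t < lcp t r -> lcp s r = lcp s t.
Proof.
move=> lt; apply/eqP; rewrite eqn_leq (lcp_trans (leqnn _) (ltnW lt)) andbT.
rewrite leqNgt; apply/negP => lt'.
by move: lt; rewrite (lcpC t) => /(lcp_trans lt'); rewrite ltnn.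
Qed.

Lemma nth_lcp x0 s t i : i < lcp s t -> nth x0 s i = nth x0 t i.
Proof.
rewrite lcp_take => /and3P[_ _ /eqP e].
by rewrite -(@nth_take i.+1) // e nth_take.
Qed.
End Lcp.

Local Open Scope group_scope.

(** * The free group of reduced words *)

Section FreeGroup.
Variable I : choiceType.

(** The Boolean is [true] on inverse letters. *)
Definition letter : Type := (I * bool)%type.
HB.instance Definition _ := Choice.on letter.
Implicit Types (x y : letter) (s t : seq letter).

Definition linv x : letter := (x.1, ~~ x.2).

Lemma linvK : involutive linv.
Proof. by case=> i b; rewrite /linv negbK. Qed.

Lemma linv_neq x : linv x != x.
Proof. by case: x => i []; rewrite /linv xpair_eqE andbF. Qed.

Definition reduced s := sorted (fun x y => y != linv x) s.

Definition push x s :=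
  if s is y :: s' then if y == linv x then s' else x :: s else [:: x].

Definition concat s t := foldr push t s.
Definition winv s := rev (map linv s).

Lemma reduced_behead x s : reduced (x :: s) -> reduced s.
Proof. exact: path_sorted. Qed.

Lemma push_reduced x s : reduced s -> reduced (push x s).
Proof.
case: s => [|y s] //= sP; case: eqVneq => [_|ne]; first exact: path_sorted sP.
by rewrite /reduced /= ne.
Qed.

Lemma concat_reduced s t : reduced t -> reduced (concat s t).
Proof. by move=> tP; elim: s => //= x s; apply: push_reduced. Qed.

Lemma concat_cat s t : reduced (s ++ t) -> concat s t = s ++ t.
Proof.
elim: s => //= x s IHs red; rewrite IHs; last exact: reduced_behead red.
case: (s ++ t) red => //= y r /andP[/negbTE -> //].
Qed.

Lemma pushK x s : reduced s -> push (linv x) (push x s) = s.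
Proof.
case: s => [|y s] /=; first by rewrite linvK eqxx.
case: eqVneq => [->|ne _]; last by rewrite /= linvK eqxx.
by case: s => [|z s] //= /andP[/negbTE -> _].
Qed.

(** Pushing letters is an action of the free group on reduced words; this is
    what makes the product of reduced words associative. *)
Lemma concat_push x s t : reduced t -> reduced s ->
  concat (push x s) t = push x (concat s t).
Proof.
move=> tP; case: s => [|y s] //= sP; case: eqVneq => [->|] //=.
by have := pushK (linv x) (concat_reduced s tP); rewrite linvK.
Qed.

Lemma concatA r s t : reduced s -> reduced t ->
  concat r (concat s t) = concat (concat r s) t.
Proof.
move=> sP tP; elim: r => //= x r ->.
by rewrite concat_push //; apply: concat_reduced.
Qed.

Lemma winv_cons x s : winv (x :: s) = rcons (winv s) (linv x).
Proof. by rewrite /winv /= rev_cons. Qed.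

Lemma winvK : involutive winv.
Proof. by move=> s; rewrite /winv map_rev revK mapK //; exact: linvK. Qed.

Lemma winv_reduced s : reduced s -> reduced (winv s).
Proof.
rewrite /reduced /winv rev_sorted sorted_map.
by apply: sub_sorted => x y; rewrite /= linvK eq_sym.
Qed.

Lemma concat_winv s t : concat (winv s) (s ++ t) = t.
Proof.
elim: s => //= x s IHs.
by rewrite winv_cons -cats1 /concat foldr_cat /= linvK eqxx.
Qed.

(** After the common prefix of [s] and [t] is cancelled, the two letters that
    meet differ, so the rest is already reduced. *)
Lemma size_concat_winv s t : reduced s -> reduced t ->
  size (concat (winv s) t) + (lcp s t).*2 = size s + size t.
Proof.
elim: s t => [|x s IHs] [|y t] sP tP.
- by [].
- by rewrite /= addn0.
- by rewrite concat_cat cats0 ?winv_reduced //= size_rev size_map /= !addn0.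
rewrite [lcp _ _]/=; case: eqVneq tP => [<- tP|ne tP].
  rewrite winv_cons -cats1 /concat foldr_cat /= linvK eqxx.
  have := IHs t (reduced_behead sP) (reduced_behead tP); rewrite /concat; lia.
rewrite concat_cat; first by rewrite size_cat size_rev size_map /=; lia.
have := winv_reduced sP; rewrite winv_cons /reduced -cats1 -catA.
case: (winv s) => [|z w] /=; first by rewrite linvK eq_sym ne.
by rewrite !cat_path /= andbT linvK => /andP[-> ->] /=; rewrite eq_sym ne.
Qed.

(** The middle letter, or the middle pair of letters, of a word never cancels
    against itself: this is where freeness excludes torsion. *)
Lemma lcp_winv s : reduced s -> 0 < size s -> (lcp (winv s) s).*2 < size s.
Proof.
move=> sP n0; rewrite ltnNge; apply/negP => le.
have [x0 _] : exists x0 : letter, true by case: s n0 {sP le} => // x; exists x.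
pose i := ((size s).-1)./2.
have il : i < lcp (winv s) s by rewrite /i; lia.
have iN : i < size s by rewrite /i; lia.
have := nth_lcp x0 il; rewrite /winv nth_rev size_map //.
rewrite (nth_map x0); last by lia.
have [e|e] : size s - i.+1 = i \/ size s - i.+1 = i.+1 by rewrite /i; lia.
  by rewrite e => /eqP; rewrite (negbTE (linv_neq _)).
rewrite e => e'; have lt : i.+1 < size s by lia.
by move/sortedP: sP => /(_ x0 i lt); rewrite -e' linvK eqxx.
Qed.

Record fgroup := FGroup { word :> seq letter; wordP : reduced word }.
HB.instance Definition _ := [isSub for word].
HB.instance Definition _ := [Choice of fgroup by <:].

Definition fgroup1 := @FGroup [::] isT.
Definition fgroup_mul (u v : fgroup) := FGroup (concat_reduced u (wordP v)).
Definition fgroup_inv (u : fgroup) := FGroup (winv_reduced (wordP u)).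

Lemma fgroup_mulA : associative fgroup_mul.
Proof. by move=> u v w; apply: val_inj; apply: concatA; apply: wordP. Qed.
Lemma fgroup_mul1g : left_id fgroup1 fgroup_mul.
Proof. by move=> u; apply: val_inj. Qed.
Lemma fgroup_mulg1 : right_id fgroup1 fgroup_mul.
Proof.
by move=> u; apply: val_inj; rewrite /= concat_cat cats0 // wordP.
Qed.
Lemma fgroup_mulVg : left_inverse fgroup1 fgroup_inv fgroup_mul.
Proof.
by move=> u; apply: val_inj; rewrite /= -{2}[word u]cats0 concat_winv.
Qed.
Lemma fgroup_mulgV : right_inverse fgroup1 fgroup_inv fgroup_mul.
Proof.
move=> u; apply: val_inj.
by rewrite /= -{1}(winvK u) -{2}[winv u]cats0 concat_winv.
Qed.

HB.instance Definition _ := isGroup.Build fgroup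
  fgroup_mulA fgroup_mul1g fgroup_mulg1 fgroup_mulVg fgroup_mulgV.

(** Naming the bundled group makes every operation on its elements go through
    the same structure path, so that arithmetic on lengths recognizes equal
    terms. *)
Definition free_group : groupType := fgroup.

Definition fletter (x : letter) : free_group := @FGroup [:: x] isT.
Definition fgen (i : I) : free_group := fletter (i, false).

Definition leval (G : groupType) (f : I -> G) (x : letter) : G :=
  if x.2 then (f x.1)^-1 else f x.1.

Lemma leval_linv (G : groupType) (f : I -> G) x : leval f (linv x) = (leval f x)^-1.
Proof. by case: x => i []; rewrite /leval /= ?invgK. Qed.

Definition weval (G : groupType) (f : I -> G) (s : seq letter) : G :=
  foldr (fun x g => leval f x * g) 1 s.

Lemma weval_cons (G : groupType) (f : I -> G) x s :
  weval f (x :: s) = leval f x * weval f s.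
Proof. by []. Qed.

Definition feval (G : groupType) (f : I -> G) (u : free_group) : G :=
  weval f (word u).

Lemma weval_push (G : groupType) (f : I -> G) x s :
  weval f (push x s) = leval f x * weval f s.
Proof.
case: s => [|y s] //=; case: eqVneq => //= ->.
by rewrite leval_linv mulgA mulgV mul1g.
Qed.

Lemma feval_hom (G : groupType) (f : I -> G) : monoid_morphism (feval f).
Proof.
split=> // u v; rewrite /feval /=; elim: (word u) => [|x s IHs] /=.
  by rewrite mul1g.
by rewrite weval_push IHs mulgA.
Qed.
HB.instance Definition _ (G : groupType) (f : I -> G) :=
  isUMagmaMorphism.Build free_group G (feval f) (feval_hom f).

Lemma feval_gen (G : groupType) (f : I -> G) i : feval f (fgen i) = f i.
Proof. exact: mulg1. Qed.

Lemma feval_morph (G H : groupType) (h : hom G H) (f : I -> G) u :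
  h (feval f u) = feval (h \o f) u.
Proof.
rewrite /feval; elim: (word u) => [|[i c] s IHs]; first exact: gmulf1.
by rewrite !weval_cons gmulfM IHs; case: c; rewrite /leval /= ?gmulfV.
Qed.

Lemma feval_fgen (w : free_group) : feval fgen w = w.
Proof.
apply: val_inj; rewrite /feval; case: w => s /=; elim: s => // x s IHs red.
have fgenE : leval fgen x = fletter x by apply: val_inj; case: x {red} => i [].
rewrite weval_cons fgenE /= IHs; last exact: reduced_behead red.
by case: s red {IHs} => //= y s /andP[/negbTE->].
Qed.

End FreeGroup.

(** * Length and overlap in a free group *)

Section Length.
Variable I : choiceType.
Implicit Types (u v p q : free_group I).

Definition len u : nat := size (word u).

Definition overlap u v : nat := lcp (word u) (word v).

Lemma overlapC u v : overlap u v = overlap v u.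
Proof. exact: lcpC. Qed.

Lemma overlap_lel u v : overlap u v <= len u.
Proof. exact: lcp_sizel. Qed.

Lemma overlap_ler u v : overlap u v <= len v.
Proof. exact: lcp_sizer. Qed.

Lemma overlap_trans k u v p :
  k <= overlap u v -> k <= overlap v p -> k <= overlap u p.
Proof. exact: lcp_trans. Qed.

Lemma overlap_isosceles u v p :
  overlap u v < overlap v p -> overlap u p = overlap u v.
Proof. exact: lcp_isosceles. Qed.

Lemma len_mulVg u v : len (u^-1 * v) + (overlap u v).*2 = len u + len v.
Proof. by rewrite /len size_concat_winv // wordP. Qed.

Lemma len_mulg u v : len (u * v) + (overlap u^-1 v).*2 = len u + len v.
Proof.
by rewrite -{1}(invgK u) len_mulVg /len /= size_rev size_map.
Qed.

Lemma len_invg u : len u^-1 = len u.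
Proof. by rewrite /len /= size_rev size_map. Qed.

Lemma len_eq0 u : (len u == 0) = (u == 1).
Proof. by rewrite /len size_eq0. Qed.

(** What [u] keeps in front of [u * v] and what it loses there add up to [u]. *)
Lemma overlap_mulg u v : overlap u (u * v) + overlap u^-1 v = len u.
Proof.
by have := len_mulVg u (u * v); have := len_mulg u v; rewrite mulKg; lia.
Qed.

Lemma prefix_exists u k : k <= len u -> exists2 p, len p = k & overlap p u = k.
Proof.
move=> ku; have red : reduced (take k (word u)) by apply/take_sorted/wordP.
exists (FGroup red : free_group I); first exact: size_takel.
apply/eqP; rewrite eqn_leq {1}/overlap /= -[X in _ <= X](size_takel ku) lcp_sizel.
by rewrite /overlap lcp_take /= size_takel // take_takel // leqnn eqxx andbT.
Qed.

Lemma overlap_self u : u != 1 -> (overlap u^-1 u).*2 < len u.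
Proof. by rewrite -len_eq0 -lt0n; apply/lcp_winv/wordP. Qed.

End Length.

(** * Substitutions with little cancellation *)

Section NoCancellation.
Variables (I J : choiceType) (f : I -> free_group J).
Let X := leval f.
Hypothesis X_neq1 : forall x, X x != 1.
Hypothesis cut_le : forall x y, y != linv x ->
  (overlap (X x)^-1 (X y)).*2 <= len (X y).
Hypothesis cut_lt : forall x y z, y != linv x -> z != linv y ->
  overlap (X x)^-1 (X y) + overlap (X y)^-1 (X z) < len (X y).

Lemma cut_le_left x y : y != linv x -> (overlap (X x)^-1 (X y)).*2 <= len (X x).
Proof.
move=> xy; have := @cut_le (linv y) (linv x).
rewrite /X !leval_linv invgK overlapC len_invg; apply.
by rewrite linvK eq_sym.
Qed.

(** The cancellation between [X x] and the value of the remaining word is seen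
    already at the next letter [y], because what survives of [X y] on its right
    is longer than its overlap with [X x]. The length bound carries the
    induction: it leaves more letters at the front of the value than the next
    factor on the left can cancel. *)
Lemma weval_cancel x y s : reduced [:: x, y & s] ->
  overlap (X x)^-1 (weval f (y :: s)) = overlap (X x)^-1 (X y) /\
  len (X x) < len (weval f [:: x, y & s]) + overlap (X x)^-1 (X y).
Proof.
have len_pos z : 0 < len (X z) by rewrite lt0n len_eq0.
elim: s x y => [|z s IHs] x y.
  rewrite /reduced [sorted _ _]/= andbT !weval_cons mulg1 -/(X x) -/(X y) => xy.
  split=> //.
  have := len_mulg (X x) (X y); have := cut_le xy; have := len_pos y; lia.
case/andP=> xy red; have [eyz ltyz] := IHs y z red.
have yz : z != linv y by case/andP: red.
have lt := cut_lt xy yz.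
rewrite (weval_cons f y) -/(X y) in ltyz *.
rewrite !(weval_cons f x) (weval_cons f y) -/(X x) -/(X y).
set w := weval f (z :: s) in eyz ltyz *.
have ex : overlap (X x)^-1 (X y * w) = overlap (X x)^-1 (X y).
  by apply: overlap_isosceles; have := overlap_mulg (X y) w; lia.
by split=> //; have := len_mulg (X x) (X y * w); rewrite ex; lia.
Qed.

(** At least half of the first factor survives, followed by one more letter. *)
Lemma len_feval_gt1 (w : free_group I) : 1 < len w -> 1 < len (feval f w).
Proof.
rewrite /feval [len w]/len; case: (word w) (wordP w) => [|x [|y s]] // red _.
have [_] := weval_cancel red.
have xy : y != linv x by case/andP: red.
have := cut_le_left xy; have := X_neq1 x; rewrite -len_eq0; lia.
Qed.

End NoCancellation.

(** * Nielsen equivalence of pairs *)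

Section Nielsen.
Variable G : groupType.
Implicit Types u v x y g : G.

(** Conjugations are among the moves because they are used to shorten pairs with a
    complete cancellation. *)
Inductive nielsen u v : G -> G -> Prop :=
| nielsen_refl : nielsen u v u v
| nielsen_inv x y : nielsen u v x y -> nielsen u v x^-1 y
| nielsen_swap x y : nielsen u v x y -> nielsen u v y x
| nielsen_mul x y : nielsen u v x y -> nielsen u v (x * y) y
| nielsen_conj g x y : nielsen u v x y -> nielsen u v (x ^ g) (y ^ g).

Lemma nielsen_trans u v x y x' y' :
  nielsen u v x y -> nielsen x y x' y' -> nielsen u v x' y'.
Proof.
move=> uv; elim=> //; intros; by [apply: nielsen_inv | apply: nielsen_swap
  | apply: nielsen_mul | apply: nielsen_conj].
Qed.

Lemma nielsen_invr u v x y : nielsen u v x y -> nielsen u v x y^-1.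
Proof. by move=> uv; apply/nielsen_swap/nielsen_inv/nielsen_swap. Qed.

Definition generating u v := forall H : set G, subgroup H -> H u -> H v ->
  forall x, H x.

Lemma nielsen_sym u v x y : nielsen u v x y -> nielsen x y u v.
Proof.
elim=> {x y} [|x y _|x y _|x y _|g x y _]; first exact: nielsen_refl.
- apply: nielsen_trans; rewrite -{2}(invgK x).
  exact/nielsen_inv/nielsen_refl.
- exact/nielsen_trans/nielsen_swap/nielsen_refl.
- apply: nielsen_trans.
  have /nielsen_invr/nielsen_mul/nielsen_invr := nielsen_refl (x * y) y.
  by rewrite invgK mulgK.
- apply: nielsen_trans; rewrite -{2}(conjgK g x) -{2}(conjgK g y).
  exact/nielsen_conj/nielsen_refl.
Qed.

Lemma nielsen_generating u v x y :
  nielsen u v x y -> generating u v -> generating x y.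
Proof.
elim=> {x y} // [x y _ IH|x y _ IH|x y _ IH|g x y _ IH] /IH gen H sH;
  have [H1 HM HV] := sH => Hx Hy.
- by apply: gen => //; rewrite -[x]invgK; apply: HV.
- exact: gen.
- by apply: gen => //; rewrite -[x](mulgK y); apply/HM/HV.
move=> z; rewrite -(conjgKV g z); apply: (gen (fun z => H (z ^ g))) => //.
split=> [|x' y'|x']; rewrite ?conj1g ?conjMg ?conjVg //; first exact: HM.
exact: HV.
Qed.

(** A single generator would make the group abelian. *)
Lemma generating_commute u x y : generating u 1 -> commute x y.
Proof.
have centS (z : G) : subgroup (fun t => commute z t).
  by split=> *; [apply: commute1 | apply: commuteM | apply: commuteV].
move=> gen; apply: (gen _ (centS x)); last exact: commute1.
apply/commute_sym/(gen _ (centS u)); last exact: commute1.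
exact: commute_refl.
Qed.

End Nielsen.

Lemma gmulf_nielsen (G H : groupType) (h : hom G H) (u v x y : G) :
  nielsen u v x y -> nielsen (h u) (h v) (h x) (h y).
Proof.
elim=> {x y} [|x y _|x y _|x y _|g x y _];
  rewrite ?gmulfJ ?gmulfV ?gmulfM; by [apply: nielsen_refl | apply: nielsen_inv
  | apply: nielsen_swap | apply: nielsen_mul | apply: nielsen_conj].
Qed.

(** * Pairs of minimal length *)

Section Minimal.
Variable J : choiceType.
Implicit Types u v x y : free_group J.

Definition nielsen_minimal u v :=
  forall x y, nielsen u v x y -> len u + len v <= len x + len y.

Lemma nielsen_minimal_exists u v :
  exists x y, nielsen u v x y /\ nielsen_minimal x y.
Proof.
have [n] := ubnP (len u + len v); elim: n u v => // n IHn u v le_n.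
have [|/existsNP[x /existsNP[y /not_implyP[uvxy /negP]]]] := EM (nielsen_minimal u v).
  by exists u, v; split=> //; apply: nielsen_refl.
rewrite -ltnNge => lt; have [|x' [y' [xyxy' min]]] := IHn x y; first by lia.
by exists x', y'; split=> //; apply: nielsen_trans xyxy'.
Qed.

Lemma nielsen_minimal_eq u v x y : nielsen_minimal u v -> nielsen u v x y ->
  len x + len y = len u + len v -> nielsen_minimal x y.
Proof. by move=> min uvxy e x' y' /(nielsen_trans uvxy)/min; rewrite -e. Qed.

Lemma nielsen_minimal_swap u v : nielsen_minimal u v -> nielsen_minimal v u.
Proof.
move=> min; apply: nielsen_minimal_eq min _ _; last exact: addnC.
exact/nielsen_swap/nielsen_refl.
Qed.

Lemma nielsen_minimal_inv u v : nielsen_minimal u v -> nielsen_minimal u^-1 v.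
Proof.
move=> min; apply: nielsen_minimal_eq min _ _; last by rewrite len_invg.
exact/nielsen_inv/nielsen_refl.
Qed.

Lemma nielsen_minimal_invr u v : nielsen_minimal u v -> nielsen_minimal u v^-1.
Proof.
by move=> min; apply/nielsen_minimal_swap/nielsen_minimal_inv/nielsen_minimal_swap.
Qed.

Lemma nielsen_minimal_cut u v : nielsen_minimal u v ->
  (overlap u^-1 v).*2 <= len v.
Proof.
move=> /(_ _ _ (nielsen_mul (nielsen_refl u v))).
have := len_mulg u v; lia.
Qed.

(** If [v = p * q] cancelled completely between two copies of [u], then
    [u = q^-1 * m * p^-1], and conjugating [u * v] and [v] by [q^-1] would leave
    [m] and [q * p], a shorter pair. *)
Lemma nielsen_minimal_gap u v : nielsen_minimal u v -> v != 1 ->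
  overlap u^-1 v + overlap v^-1 u < len v.
Proof.
move=> min; rewrite -len_eq0 => v0.
have c1 := nielsen_minimal_cut min.
have c2 : (overlap v^-1 u).*2 <= len v.
  have /nielsen_minimal_cut := nielsen_minimal_invr (nielsen_minimal_inv min).
  by rewrite invgK overlapC len_invg.
have c3 := nielsen_minimal_cut (nielsen_minimal_swap min).
rewrite ltnNge; apply/negP => full.
have [h ev [e1 e2]] : exists2 h, len v = h.*2 & overlap u^-1 v = h /\ overlap v^-1 u = h.
  by exists (overlap u^-1 v); lia.
have [p sp ep] : exists2 p : free_group J, len p = h & overlap p v = h.
  by apply: prefix_exists; lia.
(* [p] is the first half of [v] and [q] the second half. *)
pose q : free_group J := p^-1 * v; have sq : len q = h.
  by have := len_mulVg p v; rewrite -/q; lia.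
have ovq : overlap q^-1 v^-1 = h.
  have := len_mulVg q^-1 v^-1.
  by rewrite invgK /q mulgK !len_invg -/q; lia.
have le1 : h <= overlap q^-1 u by apply: (@overlap_trans _ _ _ v^-1); rewrite ?ovq ?e2.
have sm : len (q * u) = len u - h.
  by have := len_mulg q u; have := overlap_lel q^-1 u; rewrite len_invg; lia.
have hm : overlap (q * u)^-1 u^-1 = len u - h.
  have := len_mulVg (q * u)^-1 u^-1.
  by rewrite invgK mulgK !len_invg; have := overlap_ler v^-1 u; lia.
have le2 : h <= overlap (q * u)^-1 p.
  apply: (@overlap_trans _ _ _ u^-1); first by rewrite hm; lia.
  by apply: (@overlap_trans _ _ _ v); [rewrite e1 | rewrite overlapC ep].
have := min _ _ (nielsen_conj q^-1 (nielsen_mul (nielsen_refl u v))).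
have -> : (u * v) ^ q^-1 = q * u * p.
  by rewrite conjgE invgK /q invgM invgK !mulgA mulgK.
have -> : v ^ q^-1 = q * p.
  by rewrite conjgE invgK /q invgM invgK !mulgA mulgK.
have := len_mulg (q * u) p; have := len_mulg q p; lia.
Qed.

(** If [v] cancelled completely between [u] and [u^-1], then both [v] and [v^-1]
    would share half of their letters with the beginning of [u^-1], against
    [overlap_self]. *)
Lemma nielsen_minimal_gapV u v : nielsen_minimal u v -> v != 1 ->
  overlap u^-1 v + overlap v^-1 u^-1 < len v.
Proof.
move=> min v1; have c := nielsen_minimal_cut min.
have := overlap_self v1; rewrite !ltnNge; apply: contra => full.
have c' : (overlap v^-1 u^-1).*2 <= len v.
  by have := nielsen_minimal_cut (nielsen_minimal_invr min); rewrite overlapC len_invg.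
suff : overlap v^-1 u^-1 <= overlap v^-1 v by lia.
by apply: (@overlap_trans _ _ _ u^-1) => //; lia.
Qed.
End Minimal.

Definition pair_fun (T : Type) (u v : T) (b : bool) := if b then v else u.

(** * Generating pairs of the free group of rank 2 *)

Section NielsenTheorem.
Variables u v : free_group bool.
Let f := pair_fun u v.
Let X := leval f.
Let a := fgen false.
Let b := fgen true.

Lemma nielsen_leval x y : x.1 != y.1 -> nielsen u v (X x) (X y).
Proof.
by case: x y => [[] []] [[] []] // _; rewrite /X /leval /f /=;
  do ?[apply: nielsen_refl | apply: nielsen_invr | apply: nielsen_inv |
       apply: nielsen_swap; apply: nielsen_refl].
Qed.

Lemma len_leval (x : letter bool) : len (X x) = len (f x.1).
Proof. by rewrite /X /leval; case: x.2; rewrite ?len_invg. Qed.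

Lemma nielsen_minimal_leval x y : nielsen_minimal u v -> x.1 != y.1 ->
  nielsen_minimal (X x) (X y).
Proof.
move=> min xy; apply: nielsen_minimal_eq min (nielsen_leval xy) _.
by rewrite !len_leval; case: x y xy => [[] ?] [[] ?] //= _; rewrite addnC.
Qed.

Lemma minimal_generating_letters : nielsen_minimal u v -> generating u v ->
  nielsen u v a b.
Proof.
move=> min gen.
(* The generators [a] and [b] do not commute, so neither [u] nor [v] is trivial,
   and the letters whose values are [a] and [b] differ by more than a sign. *)
have nab : ~ commute a b by move/(congr1 (@word bool)).
have f_neq1 i : f i != 1.
  apply/eqP; case: i => /= e1; apply: nab.
    by apply: (@generating_commute _ u); rewrite -e1.
  apply: (@generating_commute _ v) => H sH Hv H1.
  by apply: gen => //; rewrite [u]e1.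
have X_neq1 x : X x != 1 by rewrite -len_eq0 len_leval len_eq0.
have XV (x y : letter bool) : x.1 = y.1 -> y = x \/ y = linv x.
  by case: x y => [i []] [j []] /= <-; auto.
have self x : (overlap (X x)^-1 (X x)).*2 < len (X x) by apply: overlap_self.
have cut_le x y : y != linv x -> (overlap (X x)^-1 (X y)).*2 <= len (X y).
  move=> xy; have [e|ne] := eqVneq x.1 y.1.
    have [->|e'] := XV _ _ e; first exact/ltnW/self.
    by rewrite e' eqxx in xy.
  exact/nielsen_minimal_cut/nielsen_minimal_leval.
have cut_lt x y z : y != linv x -> z != linv y ->
    overlap (X x)^-1 (X y) + overlap (X y)^-1 (X z) < len (X y).
  move=> xy yz; have cxy := cut_le _ _ xy.
  have cyz := @cut_le_left _ _ f cut_le _ _ yz.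
  rewrite -/X in cyz.
  have [e|ne] := eqVneq x.1 y.1.
    have [e'|e'] := XV _ _ e; last by rewrite e' eqxx in xy.
    by rewrite e' in cxy cyz *; have := self x; lia.
  have [e|ne'] := eqVneq y.1 z.1.
    have [e'|e'] := XV _ _ e; last by rewrite e' eqxx in yz.
    by rewrite e' in cxy cyz *; have := self y; lia.
  have mxy := nielsen_minimal_leval min ne.
  have e : x.1 = z.1 by case: x.1 y.1 z.1 ne ne' => [] [] [].
  have [->|->] := XV _ _ e; first exact: nielsen_minimal_gap.
  by rewrite /X leval_linv; apply: nielsen_minimal_gapV.
have letterP (t : free_group bool) : len t = 1%N -> exists x, t = X x.
  move=> st; have [w ew] : exists w, t = feval f w.
    move: t {st}; apply: (gen (fun t => exists w, t = feval f w)).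
    - split=> [|_ _ [w ->] [w' ->]|_ [w ->]].
      + by exists 1; rewrite gmulf1.
      + by exists (w * w'); rewrite gmulfM.
      + by exists w^-1; rewrite gmulfV.
    - by exists (fgen false); rewrite feval_gen.
    - by exists (fgen true); rewrite feval_gen.
  have := @len_feval_gt1 _ _ f X_neq1 cut_le cut_lt w; rewrite -ew st.
  rewrite {t}ew /feval [len w]/len in st *.
  case: (word w) st => [|x [|y s]] // _; last by move/(_ isT).
  by exists x; rewrite weval_cons mulg1.
have [x ea] := letterP a erefl; have [y eb] := letterP b erefl.
rewrite ea eb; apply: nielsen_leval; apply/eqP => /XV e; apply: nab.
rewrite ea eb; case: e => ->; rewrite /X ?leval_linv; do ?apply: commuteV.
  exact: commute_refl.
exact: commute_refl.
Qed.

End NielsenTheorem.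

Theorem free2_generating_nielsen (u v : free_group bool) : generating u v ->
  nielsen (fgen false) (fgen true) u v.
Proof.
move=> gen; have [x [y [uvxy min]]] := nielsen_minimal_exists u v.
apply/nielsen_sym/(nielsen_trans uvxy).
by apply: minimal_generating_letters min _; apply: nielsen_generating gen.
Qed.

(** * Positive pairs *)

Section PositiveBases.
Variables (G : groupType) (a b : G).
Implicit Types u v x y g : G.

Definition upto_inv u x := x = u \/ x = u^-1.

Lemma upto_invV u x : upto_inv u x -> upto_inv u x^-1.
Proof. by case=> ->; [right | left; rewrite invgK]. Qed.

Lemma upto_invJ g u x : upto_inv u x -> upto_inv (u ^ g) (x ^ g).
Proof. by case=> ->; [left | right; rewrite conjVg]. Qed.

Inductive positive : G -> G -> Prop :=
| positive_gens x y : upto_inv a x -> upto_inv b y -> positive x y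
| positive_swap u v : positive u v -> positive v u
| positive_mul u v : positive u v -> positive (u * v) v
| positive_conj g u v : positive u v -> positive (u ^ g) (v ^ g).

Definition signed_positive x y :=
  exists u v, [/\ positive u v, upto_inv u x & upto_inv v y].

Lemma positive_signed u v : positive u v -> signed_positive u v.
Proof. by exists u, v; split=> //; left. Qed.

Lemma signed_positive_inv x y : signed_positive x y -> signed_positive x^-1 y.
Proof. by move=> [u [v [uv ux vy]]]; exists u, v; split=> //; apply: upto_invV. Qed.

Lemma signed_positive_swap x y : signed_positive x y -> signed_positive y x.
Proof. by move=> [u [v [/positive_swap uv ux vy]]]; exists v, u. Qed.

Lemma signed_positive_invr x y : signed_positive x y -> signed_positive x y^-1.
Proof. by move=> /signed_positive_swap/signed_positive_inv/signed_positive_swap. Qed.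

Lemma signed_positive_conj g x y :
  signed_positive x y -> signed_positive (x ^ g) (y ^ g).
Proof.
move=> [u [v [uv ux vy]]]; exists (u ^ g), (v ^ g).
by split; [apply: positive_conj | apply: upto_invJ | apply: upto_invJ].
Qed.

(** After the multiplication [(x y, y)], one division gives back [(x, y)] and the
    other gives [(x y, x^-1)], where [(x y, x)] is conjugate to [(y x, x)]. For an
    initial pair [(x, y)] the division by [y] is the multiplication by the letter
    [y^-1] of the initial pair [(x, y^-1)]. *)
Lemma positive_div u v : positive u v ->
  signed_positive (u * v^-1) v /\ signed_positive u (v * u^-1).
Proof.
elim=> {u v} [x y ax by_|u v _ [IH1 IH2]|u v uv _|g u v _ [IH1 IH2]].
- split.
    rewrite -[y in signed_positive _ y]invgK; apply: signed_positive_invr.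
    by apply/positive_signed/positive_mul/positive_gens => //; apply: upto_invV.
  rewrite -[x in signed_positive x]invgK; apply: signed_positive_inv.
  apply/signed_positive_swap/positive_signed/positive_mul/positive_swap.
  by apply: positive_gens => //; apply: upto_invV.
- by split; apply: signed_positive_swap.
- split; first by rewrite mulgK; apply: positive_signed.
  rewrite invgM mulVKg; apply: signed_positive_invr.
  have -> : u * v = (v * u) ^ u^-1 by rewrite conjgE invgK !mulgA mulgK.
  have {3}-> : u = u ^ u^-1 by rewrite conjgE invgK mulgV mulg1.
  exact/positive_signed/positive_conj/positive_mul/positive_swap.
- rewrite -!conjVg -!conjMg.
  by split; apply: signed_positive_conj.
Qed.

Lemma nielsen_signed_positive u v : nielsen a b u v -> signed_positive u v.
Proof.
elim=> {u v} [|x y _|x y _|x y _|g x y _].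
- by apply/positive_signed/positive_gens; left.
- exact: signed_positive_inv.
- exact: signed_positive_swap.
- case=> u [v [uv [] -> [] ->]].
  + exact/positive_signed/positive_mul.
  + by apply: signed_positive_invr; have [] := positive_div uv.
  + have -> : u^-1 * v = ((u * v^-1)^-1) ^ v.
      by rewrite conjgE invgM invgK !mulgA mulVg mul1g.
    have {3}-> : v = v ^ v by rewrite conjgE mulKg.
    apply/signed_positive_conj/signed_positive_inv.
    by have [] := positive_div uv.
  + apply: signed_positive_invr; rewrite -invgM; apply: signed_positive_inv.
    have -> : v * u = (u * v) ^ v^-1 by rewrite conjgE invgK !mulgA mulgK.
    have {3}-> : v = v ^ v^-1 by rewrite conjgE invgK mulgV mulg1.
    exact/positive_signed/positive_conj/positive_mul.
- exact: signed_positive_conj.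
Qed.

(** The two indices count the letters [x] and [y]; they determine the class of
    the word in the abelianization. *)
Inductive posword x y : nat -> nat -> G -> Prop :=
| posword1 : posword x y 0 0 1
| poswordl p q w : posword x y p q w -> posword x y p.+1 q (x * w)
| poswordr p q w : posword x y p q w -> posword x y p q.+1 (y * w).

Lemma posword_mul x y p q w p' q' w' : posword x y p q w ->
  posword x y p' q' w' -> posword x y (p + p') (q + q') (w * w').
Proof.
move=> + w'P; elim=> {p q w} [|p q w _|p q w _]; first by rewrite mul1g.
- by rewrite -mulgA; apply: poswordl.
- by rewrite -mulgA; apply: poswordr.
Qed.

Lemma positive_posword u v : positive u v -> exists g x y,
  [/\ upto_inv a x, upto_inv b y, exists p q, posword x y p q (u ^ g)
    & exists p q, posword x y p q (v ^ g)].
Proof.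
elim=> {u v} [x y ax by_|u v _|u v _|h u v _].
- exists 1, x, y; rewrite !conjg1; split=> //.
    exists 1%N, 0%N; rewrite -[x in posword _ _ _ _ x]mulg1; do 2!constructor.
  exists 0%N, 1%N; rewrite -[y in posword _ _ _ _ y]mulg1; do 2!constructor.
- by move=> [g [x [y [ax by_ up vp]]]]; exists g, x, y.
- move=> [g [x [y [ax by_ [p [q up]] [p' [q' vp]]]]]]; exists g, x, y.
  split=> //; [exists (p + p'), (q + q') | by exists p', q'].
  by rewrite conjMg; apply: posword_mul.
- move=> [g [x [y [ax by_ up vp]]]]; exists (h^-1 * g), x, y.
  by rewrite !conjgM !conjgK.
Qed.

End PositiveBases.

(** * Degrees and the abelianization *)

(** The additive group of the integers as the target of multiplicative
    morphisms. *)
Definition mint : Type := int.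
HB.instance Definition _ := Choice.on mint.
Definition mint_mul (m n : mint) : mint := (m + n)%R.
Definition mint_inv (m : mint) : mint := (- m)%R.
HB.instance Definition _ := isGroup.Build mint
  (@GRing.addrA int : associative mint_mul) (@GRing.add0r int)
  (@GRing.addr0 int) (@GRing.addNr int : left_inverse _ mint_inv mint_mul)
  (@GRing.addrN int).

Section Degree.
Variables (G : groupType) (l : hom G mint).
Implicit Types x y w : G.

Definition degree x : int := l x.

Lemma degreeM x y : degree (x * y) = (degree x + degree y)%R.
Proof. by rewrite /degree gmulfM. Qed.

Lemma degreeV x : degree x^-1 = (- degree x)%R.
Proof. by rewrite /degree gmulfV. Qed.

Lemma degree1 : degree 1 = 0%R.
Proof. by rewrite /degree gmulf1. Qed.

Lemma degreeJ x y : degree (x ^ y) = degree x.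
Proof. by rewrite conjgE !degreeM degreeV; lia. Qed.

Lemma degree_commutator x : commutator_subgroup G x -> degree x = 0%R.
Proof.
apply: (smallest_sub (X := [set x | degree x = 0%R])) => [|_ [y [z ->]]].
  split=> [|y z|y] /=; rewrite ?degree1 ?degreeM ?degreeV; lia.
by rewrite /= /commg !(degreeM, degreeV); lia.
Qed.

Lemma degree_upto_inv x y : upto_inv x y ->
  degree y = degree x \/ degree y = (- degree x)%R.
Proof. by case=> ->; rewrite ?degreeV; auto. Qed.

Lemma degree_posword x y p q w : posword x y p q w ->
  degree w = (degree x * p%:Z + degree y * q%:Z)%R.
Proof.
elim=> {p q w} [|p q w _ IH|p q w _ IH]; first by rewrite degree1; lia.
- by rewrite degreeM IH; lia.
- by rewrite degreeM IH; lia.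
Qed.
End Degree.

Lemma posword_left (G : groupType) (x y w : G) : posword x y 1 0 w -> w = x.
Proof.
move=> H; inversion H as [|p q w' H'|]; subst.
by inversion H'; rewrite mulg1.
Qed.

Lemma posword_right (G : groupType) (x y w : G) : posword x y 0 1 w -> w = y.
Proof.
move=> H; inversion H as [| |p q w' H']; subst.
by inversion H'; rewrite mulg1.
Qed.

(** The degrees [k] and [l] are the coordinates of the abelianization. They force
    the positive words conjugate to [u^±1] and [v^±1] to be single letters, and
    then fix the signs. *)
Theorem nielsen_IA (G : groupType) (k l : hom G mint) (a b u v : G) :
  degree k a = 1%R -> degree k b = 0%R -> degree l a = 0%R -> degree l b = 1%R ->
  degree k u = 1%R -> degree k v = 0%R -> degree l u = 0%R -> degree l v = 1%R ->
  nielsen a b u v -> exists g, a = u ^ g /\ b = v ^ g.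
Proof.
move=> ka kb la lb ku kv lu lv /nielsen_signed_positive[u0 [v0 [pos uu vv]]].
have [g [x [y [ax by_ [p [q up]] [p' [q' vp]]]]]] := positive_posword pos.
exists g; have := (degree_posword k up, degree_posword l up).
have := (degree_posword k vp, degree_posword l vp); rewrite !degreeJ.
move: (degree_upto_inv k ax) (degree_upto_inv l ax).
move: (degree_upto_inv k by_) (degree_upto_inv l by_).
move: (degree_upto_inv k uu) (degree_upto_inv l uu).
move: (degree_upto_inv k vv) (degree_upto_inv l vv).
rewrite ka kb la lb ku kv lu lv => kv0 lv0 ku0 lu0 ky ly kx lx [kvp lvp] [kup lup].
have [pE qE] : p = 1%N /\ q = 0%N by nia.
have [p'E q'E] : p' = 0%N /\ q' = 1%N by nia.
subst p q p' q'; have := upto_invJ g uu; have := upto_invJ g vv.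
rewrite (posword_left up) (posword_right vp) => vy ux.
split.
  have := degreeJ k u g; rewrite ku.
  by case: ux => ->; case: ax => -> //; rewrite ?invgK // degreeV ka.
have := degreeJ l v g; rewrite lv.
by case: vy => ->; case: by_ => -> //; rewrite ?invgK // degreeV lb.
Qed.

(** * Automorphisms trivial modulo R *)

Lemma fgroup_generating (G : groupType) (f : bool -> G) :
  (forall x, exists w, x = feval f w) -> generating (f false) (f true).
Proof.
move=> surj H [H1 HM HV] Hf Ht x; have [w ->] := surj x.
rewrite /feval; elim: (word w) => // y s IHs; rewrite weval_cons; apply: HM => //.
by case: y => [[] []]; rewrite /leval /=; try apply: HV.
Qed.

Lemma generating_morph (G H : groupType) (h : hom G H) (u v : G) :
  (forall y, exists x, y = h x) -> generating u v -> generating (h u) (h v).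
Proof.
move=> surj gen K [K1 KM KV] Ku Kv y; have [x ->] := surj y.
apply: (gen (fun x => K (h x))) => //.
split=> [|x1 x2|x1]; rewrite ?gmulf1 ?gmulfM ?gmulfV //; [exact: KM | exact: KV].
Qed.

Local Open Scope classical_set_scope.

Theorem theorem1p3 (F2 : groupType) (F2_free : free_of_rank 2 F2)
    (R : normal_subgroup F2) (sRF : R `<=` commutator_subgroup F2)
    (phi : Stab R) (phi_ker : ker_rho R phi) :
  exists s : F2, sval phi =1 inner s /\ center (quot R) (coset R s).
Proof.
have [e e_basis] := F2_free.
pose a := e ord0; pose b := e ord_max.
have hom_eq (G : groupType) (h h' : hom F2 G) : h a = h' a -> h b = h' b -> h =1 h'.
  move=> ea eb; have [h0 [_ uniq]] := e_basis G (h \o e).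
  have eh' : h' \o e =1 h \o e.
    move=> i; have [->|->] : i = ord0 \/ i = ord_max.
      by case: i => [[|[|]] // ?]; [left | right]; apply: val_inj.
    - by rewrite /= ea.
    - by rewrite /= eb.
  by move=> x; rewrite (uniq h') // (uniq h).
have phiR x : exists2 r, nset R r & sval phi x = x * r.
  exists (x^-1 * sval phi x); last by rewrite mulVKg.
  apply/cosetP; rewrite -rho_funE; symmetry; exact: phi_ker.
have degree_phi (l : hom F2 mint) x : degree l (sval phi x) = degree l x.
  have [r /sRF/degree_commutator r0 ->] := phiR x.
  by rewrite degreeM r0 GRing.addr0.
have [k [kE _]] := e_basis mint (fun i => if i == ord0 then 1%R else 0%R).
have [l [lE _]] := e_basis mint (fun i => if i == ord0 then 0%R else 1%R).
have [word_of [word_ofE _]] :=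
  e_basis (free_group bool) (fun i => fgen (i != ord0)).
pose ev : hom (free_group bool) F2 := feval (pair_fun a b).
have evK x : ev (word_of x) = x.
  apply: (hom_eq _ (ev \o word_of) idfun); rewrite /= /a /b.
    by rewrite [word_of _]word_ofE /= feval_gen.
  by rewrite [word_of _]word_ofE /= feval_gen.
have word_ofK w : word_of (ev w) = w.
  rewrite /ev /= feval_morph -[RHS]feval_fgen; congr (feval _ w).
  by apply/funext => -[]; rewrite /= [LHS]word_ofE.
(* Nielsen's theorem is applied to the words of [phi a] and [phi b]. *)
have gen : generating (word_of (sval phi a)) (word_of (sval phi b)).
  apply: (generating_morph (h := word_of \o sval phi)) => [w|].
    have [psi _ phiK] := aut_bij (sval phi).
    by exists (psi (ev w)); rewrite /= phiK word_ofK.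
  apply: (@fgroup_generating _ (pair_fun a b)) => x.
  by exists (word_of x); rewrite -[LHS]evK.
have nab : nielsen a b (sval phi a) (sval phi b).
  have := gmulf_nielsen ev (free2_generating_nielsen gen).
  by rewrite !evK /ev /= !feval_gen.
have [||||||||g [ag bg]] := nielsen_IA (k := k) (l := l) _ _ _ _ _ _ _ _ nab;
  rewrite ?degree_phi; try by rewrite /degree ?[k _]kE ?[l _]lE.
have phi_inner : sval phi =1 inner g^-1.
  by apply: hom_eq; rewrite /= /inner_fun;
    [rewrite [in RHS]ag | rewrite [in RHS]bg]; rewrite conjgK.
exists g^-1; split=> // c; rewrite -(cosetK c); set x := repr c.
rewrite /commute -!cosetM; apply/cosetP.
have [r Rr] := phiR x; rewrite phi_inner /= /inner_fun conjgE invgK => er.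
by rewrite invgM invgK -mulgA er mulKg.
Qed.
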